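(* Let $b\ge2$, $s\ge1$, $n\ge1$ be integers, let $P\subset\mathbb{Z}_b^{s\times n}$ be a subgroup, and let $\nu_{i,j}\in\mathbb{R}$ for $1\le i\le s$, $1\le j\le n$. Let $\nu\colon\mathbb{Z}_b^{s\times n}\to\mathbb{R}$ be the weight $\nu(A)=\sum_{i=1}^s\sum_{j=1}^n\nu_{i,j}\,\delta(a_{i,j})$ for $A=(a_{i,j})$. Then $$\mathcal{W}(P;\nu)=\sqrt{-1+\frac1{|P|}\sum_{B=(b_{i,j})\in P}\ \prod_{\substack{1\le i\le s\\1\le j\le n}}\bigl(1+\eta(b_{i,j})\,b^{-2\nu_{i,j}}\bigr)},$$ where $\eta(b_{i,j})=b-1$ if $b_{i,j}=0$ and $\eta(b_{i,j})=-1$ if $b_{i,j}\ne0$.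
   Context: $\mathbb{Z}_b=\mathbb{Z}/b\mathbb{Z}$, and $\mathbb{Z}_b^{s\times n}$ is the additive group of $s\times n$ matrices over $\mathbb{Z}_b$. $\delta(a)=0$ if $a=0$ and $\delta(a)=1$ if $a\neq0$, for $a\in\mathbb{Z}_b$. With $\omega_b=\exp(2\pi\sqrt{-1}/b)$ and $A\bullet B=\omega_b^{\sum_{i,j}a_{i,j}b_{i,j}}$, set $P^\perp=\{A\in\mathbb{Z}_b^{s\times n}\mid A\bullet B=1\text{ for all }B\in P\}$. Define $\mathcal{W}(P;\nu)=\sqrt{\sum_{A\in P^\perp\setminus\{0\}}b^{-2\nu(A)}}$. *)

(* Defs.v *)
From mathcomp Require Import all_boot all_order all_fingroup all_algebra.
From mathcomp Require Import complex.
From mathcomp Require Import reals sequences exp trigo.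

Set Implicit Arguments.
Unset Strict Implicit.
Unset Printing Implicit Defensive.

Import Order.TTheory GRing.Theory Num.Theory.

Local Open Scope ring_scope.

Definition cexp (R : realType) (z : R[i]) : R[i] :=
  ((expR (complex.Re z))%:C * (cos (complex.Im z) +i* sin (complex.Im z)))%C.

Definition omega (R : realType) (b : nat) : R[i] :=
  cexp (2 * (pi : R)%:C%C * 'i%C / b%:R).

(* The exponent is computed in 'Z_b and read through its representative in
   {0, ..., b - 1}; for 1 < b the power does not depend on the choice of
   representative because omega R b is a b-th root of unity. *)
Definition bullet (R : realType) (b s n : nat) (A B : 'M['Z_b]_(s, n)) : R[i] :=
  omega R b ^+ nat_of_ord (\sum_(i < s) \sum_(j < n) A i j * B i j).

Definition perp (R : realType) (b s n : nat) (P : {set 'M['Z_b]_(s, n)}) :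
    {set 'M['Z_b]_(s, n)} :=
  [set A | [forall B in P, bullet R A B == 1]].

Definition delta (b : nat) (a : 'Z_b) : nat := if a == 0 then 0%N else 1%N.

Definition eta (R : realType) (b : nat) (a : 'Z_b) : R :=
  if a == 0 then b%:R - 1 else - 1.

Definition weight (R : realType) (b s n : nat) (nu : 'M[R]_(s, n))
    (A : 'M['Z_b]_(s, n)) : R :=
  \sum_(i < s) \sum_(j < n) nu i j * (delta (A i j))%:R.

Definition calW (R : realType) (b s n : nat) (P : {set 'M['Z_b]_(s, n)})
    (mu : 'M['Z_b]_(s, n) -> R) : R :=
  Num.sqrt (\sum_(A in perp R P :\ 0) b%:R `^ (- (2 * mu A))).

(* Main.v *)
(* Characters of a finite group sum to zero unless trivial.  Summing A • B over
   B in P yields |P| times the indicator of the dual of P, so that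
     |P| \sum_(A in P^perp) f A = \sum_(B in P) \sum_A f A (A • B).
   As f = b^(-2 nu) is a product over the entries, so is the inner sum, and
   each factor is again evaluated by orthogonality, now over Z_b. *)
Require Import Defs.
From mathcomp Require Import all_boot all_order all_fingroup all_algebra.
From mathcomp Require Import complex.
From mathcomp Require Import reals sequences exp trigo.
From mathcomp Require Import lra.

Set Implicit Arguments.
Unset Strict Implicit.
Unset Printing Implicit Defensive.

Import Order.TTheory GRing.Theory Num.Theory.

Local Open Scope ring_scope.

(** If [chi y] differs from 1, translation by [y] permutes [G], so the sum is fixed under
    multiplication by [chi y]; without zero divisors it must vanish. *)
Lemma sum_character (F : idomainType) (gT : finGroupType) (G : {group gT})
    (chi : gT -> F) :
  {in G &, forall x y, chi (x * y)%g = chi x * chi y} ->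
  \sum_(x in G) chi x = if [forall x in G, chi x == 1] then #|G|%:R else 0.
Proof.
move=> chiM; case: ifPn => [/forall_inP chi1|].
  by rewrite (eq_bigr (fun=> 1)) ?sumr_const // => x /chi1/eqP.
rewrite negb_forall_in => /exists_inP[y Gy chiy].
have sumE : chi y * \sum_(x in G) chi x = \sum_(x in G) chi x.
  rewrite [RHS](reindex_inj (mulgI y)) /= mulr_sumr; apply: eq_big => x.
    by rewrite groupMl.
  by move=> Gx; rewrite chiM.
move/eqP: sumE; rewrite -{2}[\sum_(x in G) _]mul1r -subr_eq0 -mulrBl mulf_eq0.
by rewrite subr_eq0 (negPf chiy) => /eqP.
Qed.

(** By the half-angle formula cos x = 1 - 2 sin^2 (x / 2), and the sine is positive on the open
    interval from 0 to pi. *)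
Lemma cos_neq1 (R : realType) (x : R) :
  0 < x < 2 * pi -> cos x != 1.
Proof.
move=> /andP[x_gt0 x_lt]; have xE : x = (x / 2) *+ 2.
  by rewrite -[RHS]mulr_natr divfK ?pnatr_eq0.
have sx : 0 < sin (x / 2).
  apply: sin_gt0_pi; rewrite divr_gt0 //=.
  by rewrite ltr_pdivrMr // mulrC.
have sx2 : 0 < sin (x / 2) ^+ 2 by rewrite exprn_gt0.
have eq1 := cos2Dsin2 (x / 2).
apply/eqP; rewrite xE cos_mulr2n mulr2n; lra.
Qed.

Lemma omegaE (R : realType) (b : nat) :
  omega R b = (cos (2 * pi / b%:R) +i* sin (2 * pi / b%:R))%C.
Proof.
rewrite /omega; have -> : 2 * pi%:C%C * 'i%C / b%:R =
    (2 * pi / b%:R)%:C%C * 'i%C :> R[i].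
  by rewrite !rmorphM fmorphV !rmorph_nat mulrAC.
by rewrite /cexp /= !(mul0r, mulr0, mulr1, subr0, addr0) expR0 mul1r.
Qed.

(** De Moivre's formula, by induction from the addition theorems. *)
Lemma omegaX (R : realType) (b k : nat) :
  omega R b ^+ k =
  (cos (k%:R * (2 * pi / b%:R)) +i* sin (k%:R * (2 * pi / b%:R)))%C.
Proof.
elim: k => [|k IHk]; first by rewrite expr0 mul0r cos0 sin0.
rewrite exprSr IHk omegaE; move: (2 * pi / _) => t.
rewrite -natr1 mulrDl mul1r cosD sinD; apply/eqP.
by rewrite eq_complex /= addrC eqxx [_ + _]addrC eqxx.
Qed.

Lemma omega_prim (R : realType) (b : nat) :
  (0 < b)%N -> b.-primitive_root (omega R b).
Proof.
move=> b_gt0; have b0 : 0 < b%:R :> R by rewrite ltr0n.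
have wb1 : omega R b ^+ b = 1.
  by rewrite omegaX mulrCA divff ?gt_eqF// mulr1 mulr_natl cos2pi sin2pi.
apply/andP; split=> //; apply/forallP => i; rewrite unity_rootE.
have [-> | neq] := eqVneq i.+1 b; first by rewrite wb1 !eqxx.
rewrite eqbF_neg omegaX eq_complex negb_and /=.
(* For an exponent k = [i.+1] below [b], the angle 2 pi k / b lies strictly between 0 and 2 pi, so
   the real part alone rules out the value 1. *)
rewrite cos_neq1 // !mulr_gt0 ?invr_gt0 ?pi_gt0 ?ltr0n //=.
rewrite mulrCA -[ltRHS]mulr1 ltr_pM2l ?mulr_gt0 ?pi_gt0 //.
by rewrite ltr_pdivrMr // mul1r ltr_nat ltn_neqAle neq ltn_ord.
Qed.

(** Distributivity: expanding the product of sums picks one element of [T] per position, that is, a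
    matrix. *)
Lemma sum_mx_prod (K : comNzRingType) (T : finType) (s n : nat)
    (f : 'I_s -> 'I_n -> T -> K) :
  \sum_(A : 'M[T]_(s, n)) \prod_(i < s) \prod_(j < n) f i j (A i j) =
  \prod_(i < s) \prod_(j < n) \sum_a f i j a.
Proof.
rewrite pair_bigA bigA_distr_bigA /=.
rewrite (reindex (fun g : {ffun 'I_s * 'I_n -> T} => Matrix g)) /=.
  by apply: eq_bigr => g _; rewrite pair_bigA; apply: eq_bigr => -[].
by exists (fun A => let: Matrix g := A in g) => // -[].
Qed.

Section Bullet.
Variables (R : realType) (b s n : nat).
Hypothesis b_gt1 : (1 < b)%N.
Implicit Types (A B : 'M['Z_b]_(s, n)).

Local Notation chi := (fun a : 'Z_b => omega R b ^+ (a : nat)).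

Let w_prim : b.-primitive_root (omega R b).
Proof. exact: omega_prim (ltnW b_gt1). Qed.

Lemma omegaXD (x y : 'Z_b) : chi (x + y) = chi x * chi y.
Proof.
rewrite /= -exprD -(prim_expr_mod w_prim (x + y)); congr (_ ^+ _).
(* Addition in ['Z_b] reduces modulo [(Zp_trunc b).+2], which is [b] because 1 < b. *)
by rewrite -[X in _ = (_ %% X)%N](Zp_cast b_gt1).
Qed.

Lemma omegaX_sum (I : Type) (r : seq I) (x : I -> 'Z_b) :
  chi (\sum_(i <- r) x i) = \prod_(i <- r) chi (x i).
Proof. exact: (big_morph chi omegaXD). Qed.

Lemma bulletE A B :
  bullet R A B = \prod_(i < s) \prod_(j < n) chi (A i j * B i j).
Proof.
by rewrite /bullet omegaX_sum; apply: eq_bigr => i _; exact: omegaX_sum.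
Qed.

Lemma bulletDr A B C : bullet R A (B + C) = bullet R A B * bullet R A C.
Proof.
rewrite -omegaXD -big_split /=; congr (_ ^+ nat_of_ord _).
apply: eq_bigr => i _; rewrite -big_split; apply: eq_bigr => j _.
by rewrite mxE mulrDr.
Qed.

(** For fixed [A] the pairing is a character of [P], trivial exactly when [A] lies in the dual. *)
Lemma sum_bullet (P : {group 'M['Z_b]_(s, n)}) A :
  \sum_(B in P) bullet R A B = if A \in perp R P then #|P|%:R else 0.
Proof.
by rewrite inE; apply: sum_character => B C _ _; exact: bulletDr.
Qed.

Lemma perp0 (P : {group 'M['Z_b]_(s, n)}) : 0 \in perp R P.
Proof.
rewrite inE; apply/forall_inP => B _; rewrite /bullet big1 ?expr0 // => i _.
by rewrite big1 // => j _; rewrite mxE mul0r.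
Qed.

Lemma sum_omegaXM (c : 'Z_b) :
  \sum_(a : 'Z_b) chi (a * c) = if c == 0 then b%:R else 0.
Proof.
have := @sum_character _ _ [set: 'Z_b]%G (fun a : 'Z_b => chi (a * c)).
have -> : #|[set: 'Z_b]| = b by rewrite cardsT card_ord Zp_cast.
move=> sumE.
rewrite (eq_bigl (fun a => a \in [set: 'Z_b])) => [|a]; last by rewrite inE.
rewrite sumE => [|x y _ _]; last by rewrite -omegaXD -mulrDl.
congr (if _ then _ else _); have [->|c0] := eqVneq c 0.
  by apply/forall_inP => a _; rewrite mulr0.
(* At a = 1 the character takes the value omega^c, which is not 1 by primitivity, since 0 < c <
   b. *)
apply/negbTE; rewrite negb_forall_in; apply/exists_inP; exists 1.
  by rewrite inE.
rewrite mul1r -[1](expr0 (omega R b)) (eq_prim_root_expr w_prim).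
by rewrite mod0n modn_small // -[X in (_ < X)%N]Zp_cast.
Qed.

(** The factor contributed by one matrix entry: a = 0 gives 1, and the characters at nonzero a add
    up to [eta R c]. *)
Lemma sum_omegaXM_if (c : 'Z_b) (t : R) :
  \sum_(a : 'Z_b) chi (a * c) * (if a == 0 then 1 else t)%:C%C =
  (1 + eta R c * t)%:C%C.
Proof.
have sumE := sum_omegaXM c.
rewrite (bigD1 0) // mul0r expr0 in sumE.
rewrite (bigD1 0) // eqxx mul0r expr0 mul1r.
rewrite (eq_bigr (fun a : 'Z_b => chi (a * c) * t%:C%C)) => [|a /negPf-> //].
rewrite -mulr_suml rmorphD rmorphM /=; congr (_ + _ * _).
(* The sum over nonzero a is the full sum, b or 0, minus the term 1 at a = 0. *)
rewrite -[LHS](addKr 1) sumE /eta; case: ifP => _.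
  by rewrite rmorphB rmorph_nat addrC.
by rewrite rmorphN addr0.
Qed.

Lemma powR_weight (nu : 'M[R]_(s, n)) A :
  b%:R `^ (- (2 * weight nu A)) =
  \prod_(i < s) \prod_(j < n)
     (if A i j == 0 then 1 else b%:R `^ (- (2 * nu i j))).
Proof.
have b0 : b%:R != 0 :> R by rewrite pnatr_eq0 -lt0n ltnW.
have powD : {morph (fun x : R => b%:R `^ (- (2 * x))) :
    x y / x + y >-> x * y}.
  by move=> x y; rewrite mulrDr opprD powRD // b0 implybT.
have pow0 : b%:R `^ (- (2 * 0)) = 1 :> R by rewrite mulr0 oppr0 powRr0.
rewrite /weight (big_morph _ powD pow0); apply: eq_bigr => i _.
rewrite (big_morph _ powD pow0); apply: eq_bigr => j _; rewrite /delta.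
by case: ifP => _; rewrite ?mulr1 ?mulr0 ?oppr0 ?powRr0.
Qed.

(** The Fourier transform of b^(-2 nu) at [B]: both factors of the summand split over the entries,
    hence so does the sum. *)
Lemma sum_bullet_powR_weight (nu : 'M[R]_(s, n)) B :
  \sum_A bullet R A B * (b%:R `^ (- (2 * weight nu A)))%:C%C =
  (\prod_(i < s) \prod_(j < n)
      (1 + eta R (B i j) * b%:R `^ (- (2 * nu i j))))%:C%C.
Proof.
under eq_bigr => A _.
  rewrite bulletE powR_weight rmorph_prod -big_split /=.
  under eq_bigr => i _ do rewrite rmorph_prod -big_split /=.
  over.
rewrite (sum_mx_prod (fun i j a => chi (a * B i j) *
  (if a == 0 then 1 else b%:R `^ (- (2 * nu i j)))%:C%C)).
rewrite rmorph_prod; apply: eq_bigr => i _.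
by rewrite rmorph_prod; apply: eq_bigr => j _; exact: sum_omegaXM_if.
Qed.

(** Poisson summation: a double sum over all [A] and over [B] in [P], evaluated in both orders. *)
Lemma sum_perp_powR_weight (P : {group 'M['Z_b]_(s, n)}) (nu : 'M[R]_(s, n)) :
  #|P|%:R * (\sum_(A in perp R P) b%:R `^ (- (2 * weight nu A))) =
  \sum_(B in P) \prod_(i < s) \prod_(j < n)
      (1 + eta R (B i j) * b%:R `^ (- (2 * nu i j))).
Proof.
(* Both sides are real, but the characters linking them are complex. *)
apply: (@complexI R); rewrite rmorphM rmorph_nat !rmorph_sum /=.
under [RHS]eq_bigr => B _ do rewrite -sum_bullet_powR_weight.
rewrite exchange_big /= big_mkcond mulr_sumr; apply: eq_bigr => A _.
by rewrite -mulr_suml sum_bullet; case: ifP; rewrite ?mul0r ?mulr0.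
Qed.

End Bullet.

Theorem theorem4 (R : realType) (b s n : nat)
    (hb : (2 <= b)%N) (hs : (1 <= s)%N) (hn : (1 <= n)%N)
    (P : {group 'M['Z_b]_(s, n)}) (nu : 'M[R]_(s, n)) :
  calW P (weight nu) =
  Num.sqrt (- 1 + #|P|%:R^-1 *
    \sum_(B in P) \prod_(i < s) \prod_(j < n)
      (1 + eta R (B i j) * b%:R `^ (- (2 * nu i j)))).
Proof.
rewrite /calW -sum_perp_powR_weight // mulKf ?pnatr_eq0 -?lt0n ?cardG_gt0 //.
(* The zero matrix lies in the dual and contributes b^0 = 1, which cancels the -1 under the root. *)
rewrite [in RHS](big_setD1 0) ?perp0 //= powR_weight //.
rewrite [X in -1 + (X + _)]big1 ?addKr // => i _.
by rewrite big1 // => j _; rewrite mxE eqxx.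
Qed.
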